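(* Let $H_0\ne0$. A principal contact element net $(m,s):\mathbb{Z}^2\to\mathbb{R}^3\times S^2$ has constant mean curvature $H_0$ if and only if the circular net $m$ is isothermic and there exists its dual discrete isothermic surface $m^*:\mathbb{Z}^2\to\mathbb{R}^3$ at constant distance $|m-m^*|=\frac1{|H_0|}$, where the unit Gauss map $s$ which determines the principal contact element net $(m,s)$ is given by $$s=H_0(m^*-m).$$ In this case the principal contact element net of the parallel surface $(m+\frac1{H_0}s,\,-s)$ also has constant mean curvature $H_0$, and the mid-surface $(m+\frac1{2H_0}s,\,s)$ has constant Gaussian curvature $4H_0^2$.
   Context: $\mathbb{Z}^2$ carries its regular quad combinatorics (elementary edges, elementary quadrilaterals as faces). A Q-net is a map $m:\mathbb{Z}^2\to\mathbb{R}^3$ all of whose elementary quadrilaterals are planar; it is circular if the vertices of each elementary quadrilateral lie on a circle. Two nets $m,s$ are parallel if for each elementary edge $(n,n')$ the vectors $m(n)-m(n')$ and $s(n)-s(n')$ are linearly dependent. A contact element net is a pair $(m,s):\mathbb{Z}^2\to\mathbb{R}^3\times S^2$, identified with the points $m$ together with the oriented planes through them orthogonal to $s$; it is principal if for every elementary edge $(n,n')$ there is $t\in\mathbb{R}$ with $(m+ts)(n)=(m+ts)(n')$. Principal contact element nets considered here are polyhedral: $m$ is a circular Q-net with parallel unit Gauss map $s$, without zero edges; corresponding faces $m(f)$, $s(f)$ lie in parallel planes. In a 2-dimensional space, $A(P)=\frac12\sum_i\det(p_i,p_{i+1})$ is the oriented area of a polygon $P$ (indices cyclic), and $A(P,Q)$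 is the associated symmetric bilinear form (mixed area), also applied to polygons in parallel planes. The mean and Gaussian curvatures of the face $f$ of $(m,s)$ are $H_f=-A(m(f),s(f))/A(m(f))$ and $K_f=A(s(f))/A(m(f))$; they are defined only for faces of nonvanishing area, which is assumed wherever a curvature is considered. Constant mean (Gaussian) curvature means $H_f$ (resp. $K_f$) is the same for all faces. Polyhedral nets $m,m'$ are Christoffel dual, $m'=m^*$, if they are parallel and $A(m(f),m'(f))=0$ for all faces $f$. A Koenigs net is a polyhedral net possessing a Christoffel dual. A net is discrete isothermic if it is a circular Koenigs net.
   Formalization: The equivalence and the claim that the parallel surface is a principal contact element net assume that m+s/H0 has no zero edges; otherwise ''only if'' fails for circular nets m on a sphere of radius 1/|H0| with s=-H0 m, where m* would be constant. *)

(* Defs.v *)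
From HB Require Import structures.
From mathcomp Require Import all_boot all_order all_algebra.
From mathcomp Require Import reals.

Set Implicit Arguments.
Unset Strict Implicit.
Unset Printing Implicit Defensive.

Import Order.TTheory GRing.Theory Num.Theory.
Local Open Scope ring_scope.

Notation Z2 := (int * int)%type.

Definition elem_edge (n n' : Z2) : Prop := n' = n + (1, 0) \/ n' = n + (0, 1).

(* A face is named by its lower left vertex; its vertices are listed in cyclic
   order. *)
Definition corner (i : 'I_4) : Z2 :=
  tnth [tuple (0, 0); (1, 0); (1, 1); (0, 1)] i.

Section Geometry.
Variable R : realType.

(* The library norm on 'rV[R]_k is the sup norm, hence this definition. *)
Definition enorm k (v : 'rV[R]_k) : R := Num.sqrt (\sum_j v 0 j ^+ 2).

Definition area k (P : 'I_k -> 'rV[R]_2) : R :=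
  2^-1 * \sum_i \det (col_mx (P i) (P (ordS i)) : 'M[R]_2).

(* Polarization: the symmetric bilinear form with mixed_area P P = area P. *)
Definition mixed_area k (P Q : 'I_k -> 'rV[R]_2) : R :=
  2^-1 * (area (fun i => P i + Q i) - area P - area Q).

(* The rows of a frame are an orthonormal basis of a 2-dimensional linear
   subspace of R^3. *)
Definition is_frame (F : 'M[R]_(2, 3)) : Prop := F *m F^T = 1%:M.

(* P lies in some affine plane whose direction is the row space of F. *)
Definition in_plane_along (F : 'M[R]_(2, 3)) k (P : 'I_k -> 'rV[R]_3) : Prop :=
  forall i j, (P i - P j <= F)%MS.

(* Orthogonal projection to the row space of F, in the coordinates given by F.
   On polygons along F this is an isometry, so areas computed in these
   coordinates depend on F only through a common sign (the orientation), which
   affects neither ratios nor the vanishing of areas. *)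
Definition coords (F : 'M[R]_(2, 3)) k (P : 'I_k -> 'rV[R]_3) :
  'I_k -> 'rV[R]_2 := fun i => P i *m F^T.

Definition planar k (P : 'I_k -> 'rV[R]_3) : Prop :=
  exists F, is_frame F /\ in_plane_along F P.

Definition concyclic k (P : 'I_k -> 'rV[R]_3) : Prop :=
  exists (F : 'M[R]_(2, 3)) (c : 'rV[R]_3) (r : R),
    [/\ is_frame F, 0 < r &
        forall i, (P i - c <= F)%MS /\ enorm (P i - c) = r].

Definition in_parallel_planes k (P Q : 'I_k -> 'rV[R]_3) : Prop :=
  exists F, [/\ is_frame F, in_plane_along F P & in_plane_along F Q].

Definition net := Z2 -> 'rV[R]_3.

Implicit Types m s : net.

Definition face m (f : Z2) : 'I_4 -> 'rV[R]_3 := fun i => m (f + corner i).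

Definition Qnet m : Prop := forall f, planar (face m f).

Definition circular m : Prop := Qnet m /\ forall f, concyclic (face m f).

Definition without_zero_edges m : Prop :=
  forall n n', elem_edge n n' -> m n != m n'.

(* Excluding zero edges is essential for the notion of dual below: a constant
   net would otherwise be Christoffel dual to every Q-net. *)
Definition polyhedral m : Prop := Qnet m /\ without_zero_edges m.

Definition parallel m s : Prop :=
  forall n n', elem_edge n n' -> ~~ free [:: m n - m n'; s n - s n'].

Definition offset m s (t : R) : net := fun n => m n + t *: s n.

Definition contact_element_net m s : Prop := forall n, enorm (s n) = 1.

Definition principal m s : Prop :=
  forall n n', elem_edge n n' -> exists t : R, offset m s t n = offset m s t n'.

Definition principal_contact_element_net m s : Prop :=
  [/\ contact_element_net m s, principal m s,
      circular m /\ polyhedral m, parallel m s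
    & forall f, in_parallel_planes (face m f) (face s f)].

Definition nonvanishing_face_areas m : Prop :=
  forall f, exists F,
    [/\ is_frame F, in_plane_along F (face m f) & area (coords F (face m f)) != 0].

(* Curvatures of a face P with Gauss image Q, both along F. *)
Definition mean_curvature (F : 'M[R]_(2, 3)) k (P Q : 'I_k -> 'rV[R]_3) : R :=
  - (mixed_area (coords F P) (coords F Q) / area (coords F P)).

Definition gauss_curvature (F : 'M[R]_(2, 3)) k (P Q : 'I_k -> 'rV[R]_3) : R :=
  area (coords F Q) / area (coords F P).

Definition has_constant_mean_curvature m s (H : R) : Prop :=
  forall f, exists F,
    [/\ is_frame F, in_plane_along F (face m f), in_plane_along F (face s f),
        area (coords F (face m f)) != 0
      & mean_curvature F (face m f) (face s f) = H].

Definition has_constant_gauss_curvature m s (K : R) : Prop :=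
  forall f, exists F,
    [/\ is_frame F, in_plane_along F (face m f), in_plane_along F (face s f),
        area (coords F (face m f)) != 0
      & gauss_curvature F (face m f) (face s f) = K].

Definition christoffel_dual m m' : Prop :=
  [/\ polyhedral m, polyhedral m', parallel m m'
    & forall f, exists F,
        [/\ is_frame F, in_plane_along F (face m f), in_plane_along F (face m' f)
          & mixed_area (coords F (face m f)) (coords F (face m' f)) = 0]].

Definition koenigs m : Prop := polyhedral m /\ exists m', christoffel_dual m m'.

Definition isothermic m : Prop := circular m /\ koenigs m.

End Geometry.

(* Main.v *)
Require Import Defs.
From mathcomp Require Import all_boot all_order all_algebra.
From mathcomp Require Import reals.
From mathcomp Require Import ring lra.

Set Implicit Arguments.
Unset Strict Implicit.
Unset Printing Implicit Defensive.

Import Order.TTheory GRing.Theory Num.Theory.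
Local Open Scope ring_scope.

(** Write m' for the offset net m + s / H0, so that s = H0 (m' - m) holds by
    construction and |m - m'| = 1 / |H0| because s is a unit field.  Everything
    about curvatures then follows from bilinearity of the mixed area on each
    face: A(m, m') = A(m) + A(m, s) / H0 vanishes exactly when the mean
    curvature - A(m, s) / A(m) is H0 ([mixed_area_offset]).  So the mean
    curvature is H0 on all faces if and only if m and m' are Christoffel dual.
    If it is, then A(m') = - A(m) + A(s) / H0^2 ([area_offset]), which gives the
    mean curvature of the parallel surface, and at half the distance the area is
    A(s) / (4 H0^2), which gives the Gaussian curvature of the mid-surface.

    What is not bilinear algebra is that m' is again circular.  It holds for
    every offset ([offset_circular]): if c is the centre of the circle through a
    face of m, then (m - c) . s takes the same value at both ends of an edge
    ([edge_symmetry]), hence |m + t s - c|^2 is constant on the face.  The face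
    of m + t s thus lies in a plane and on a sphere about c, so on a circle
    ([sphere_section_concyclic]).

    A face of nonzero area spans its plane, so its area may be tested in any
    frame of any plane that contains it ([area_change_frame]). *)

(** * Mixed areas *)

Lemma det_mx2 (R : comNzRingType) (A : 'M[R]_2) :
  \det A = A 0 0 * A 1 1 - A 0 1 * A 1 0.
Proof.
rewrite (expand_det_row _ 0) !big_ord_recl big_ord0 /cofactor !det_mx11 !mxE.
have -> : lift 0 0 = 1 :> 'I_2 by apply: val_inj.
have -> : lift 1 0 = 0 :> 'I_2 by apply: val_inj.
by rewrite /= expr0 expr1; ring.
Qed.

Lemma det_col_mx2 (R : comNzRingType) (u v : 'rV[R]_2) :
  \det (col_mx u v : 'M[R]_2) = u 0 0 * v 0 1 - u 0 1 * v 0 0.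
Proof.
have up j : (col_mx u v : 'M_2) 0 j = u 0 j.
  by rewrite -(col_mxEu u v); congr (col_mx u v _ _); apply: val_inj.
have down j : (col_mx u v : 'M_2) 1 j = v 0 j.
  by rewrite -(col_mxEd u v); congr (col_mx u v _ _); apply: val_inj.
by rewrite det_mx2 !up !down.
Qed.

Section Areas.
Variables (R : realType) (k : nat).
Implicit Types P Q : 'I_k -> 'rV[R]_2.

Lemma eq_area P Q : P =1 Q -> area P = area Q.
Proof. by move=> e; congr (_ * _); apply: eq_bigr => i _; rewrite !e. Qed.

Lemma eq_mixed_area P P' Q Q' :
  P =1 P' -> Q =1 Q' -> mixed_area P Q = mixed_area P' Q'.
Proof.
move=> eP eQ; rewrite /mixed_area (eq_area eP) (eq_area eQ).
by rewrite (@eq_area _ (fun i => P' i + Q' i)) // => i; rewrite eP eQ.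
Qed.

Lemma mixed_areaC P Q : mixed_area P Q = mixed_area Q P.
Proof.
rewrite /mixed_area (@eq_area _ (fun i => Q i + P i)) => [|i].
  by rewrite addrAC.
by rewrite addrC.
Qed.

(** The area of a polygon is a quadratic form; all the area identities below are
    instances of this expansion and of its polarized form. *)
Lemma area_comb P Q (a b : R) :
  area (fun i => a *: P i + b *: Q i) =
  a ^+ 2 * area P + 2 * a * b * mixed_area P Q + b ^+ 2 * area Q.
Proof.
rewrite /mixed_area /area.
set SP := \sum_i \det (col_mx (P i) _).
set SQ := \sum_i \det (col_mx (Q i) _).
pose M := \sum_i (P i 0 0 * Q (ordS i) 0 1 - P i 0 1 * Q (ordS i) 0 0 +
                  (Q i 0 0 * P (ordS i) 0 1 - Q i 0 1 * P (ordS i) 0 0)).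
have comb (c d : R) :
    \sum_i \det (col_mx (c *: P i + d *: Q i)
                        (c *: P (ordS i) + d *: Q (ordS i)) : 'M_2) =
    c ^+ 2 * SP + c * d * M + d ^+ 2 * SQ.
  rewrite /SP /SQ /M !mulr_sumr -!big_split /=; apply: eq_bigr => i _.
  by rewrite !det_col_mx2 !mxE; ring.
rewrite comb.
have -> : \sum_i \det (col_mx (P i + Q i) (P (ordS i) + Q (ordS i)) : 'M_2) =
    SP + M + SQ.
  have := comb 1 1; rewrite !expr1n !mul1r => <-.
  by apply: eq_bigr => i _; rewrite !scale1r.
by field.
Qed.

Lemma mixed_area_comb P Q (a b c d : R) :
  mixed_area (fun i => a *: P i + b *: Q i) (fun i => c *: P i + d *: Q i) =
  a * c * area P + (a * d + b * c) * mixed_area P Q + b * d * area Q.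
Proof.
rewrite [LHS]/mixed_area !area_comb.
rewrite (@eq_area _ (fun i => (a + c) *: P i + (b + d) *: Q i)).
  by rewrite area_comb; field.
by move=> i; rewrite !scalerDl addrACA.
Qed.

(** The terms involving the translation vector telescope around the polygon. *)
Lemma area_translate P (c : 'rV[R]_2) : area (fun i => P i + c) = area P.
Proof.
rewrite /area.
pose g i := P i 0 0 * c 0 1 - P i 0 1 * c 0 0.
have -> : \sum_i \det (col_mx (P i + c) (P (ordS i) + c) : 'M_2) =
    \sum_i \det (col_mx (P i) (P (ordS i)) : 'M_2) +
    (\sum_i g i - \sum_i g (ordS i)).
  rewrite -sumrB -big_split /=; apply: eq_bigr => i _.
  by rewrite !det_col_mx2 !mxE /g; ring.
by rewrite [\sum_i g i](reindex_inj (@ordS_inj k)) subrr addr0.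
Qed.

Lemma area_mulmx P (G : 'M[R]_2) :
  area (fun i => P i *m G) = \det G * area P.
Proof.
rewrite /area mulrCA; congr (_ * _).
rewrite mulr_sumr; apply: eq_bigr => i _.
by rewrite -(mul_col_mx (P i)) det_mulmx mulrC.
Qed.

End Areas.

(** * Frames *)

Section Frames.
Variable R : realType.
Implicit Types F : 'M[R]_(2, 3).

Lemma frame_proj F (v : 'rV[R]_3) :
  is_frame F -> (v <= F)%MS -> v *m F^T *m F = v.
Proof.
move=> hF /submxP[a ->].
by rewrite -(mulmxA a) hF mulmx1.
Qed.

(** Polygons along F are determined, up to translation, by their coordinates in
    F, and the coordinates in another frame G are a linear image of these. *)
Lemma area_change_frame F G k (P : 'I_k -> 'rV[R]_3) :
  is_frame F -> in_plane_along F P ->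
  area (coords G P) = \det (F *m G^T) * area (coords F P).
Proof.
case: k P => [|k] P hF hP; first by rewrite /area !big_ord0 !mulr0.
rewrite -area_mulmx.
rewrite -[RHS](area_translate _ (P 0 *m G^T - P 0 *m F^T *m (F *m G^T))).
apply: eq_area => i; rewrite /coords !mulmxA addrCA -!mulmxBl.
by rewrite frame_proj // mulmxBl addrC subrK.
Qed.

Lemma area_neq0_frame F k (P : 'I_k -> 'rV[R]_3) :
  is_frame F -> in_plane_along F P ->
  (exists G, [/\ is_frame G, in_plane_along G P & area (coords G P) != 0]) ->
  area (coords F P) != 0.
Proof.
move=> hF hP [G [_ _]]; rewrite (area_change_frame G hF hP).
by apply: contraNneq => ->; rewrite mulr0.
Qed.

End Frames.

(** * Spheres and circles *)

Section Circles.
Variable R : realType.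

Definition dot k (u v : 'rV[R]_k) : R := (u *m v^T) 0 0.

Lemma dotC k (u v : 'rV[R]_k) : dot u v = dot v u.
Proof. by rewrite /dot -[u in LHS]trmxK -trmx_mul mxE. Qed.

Lemma dotDl k (u v w : 'rV[R]_k) : dot (u + v) w = dot u w + dot v w.
Proof. by rewrite /dot mulmxDl mxE. Qed.

Lemma dotZl k a (u w : 'rV[R]_k) : dot (a *: u) w = a * dot u w.
Proof. by rewrite /dot -scalemxAl mxE. Qed.

Lemma dotDr k (u v w : 'rV[R]_k) : dot w (u + v) = dot w u + dot w v.
Proof. by rewrite dotC dotDl !(dotC w). Qed.

Lemma dotZr k a (u w : 'rV[R]_k) : dot w (a *: u) = a * dot w u.
Proof. by rewrite dotC dotZl (dotC w). Qed.

Lemma dotNl k (u w : 'rV[R]_k) : dot (- u) w = - dot u w.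
Proof. by rewrite -scaleN1r dotZl mulN1r. Qed.

Lemma dotNr k (u w : 'rV[R]_k) : dot w (- u) = - dot w u.
Proof. by rewrite dotC dotNl (dotC w). Qed.

Definition dotE := (dotDl, dotDr, dotNl, dotNr, dotZl, dotZr).

Lemma dot_sum k (u : 'rV[R]_k) : dot u u = \sum_j u 0 j ^+ 2.
Proof. by rewrite /dot mxE; apply: eq_bigr => j _; rewrite mxE expr2. Qed.

Lemma dot_ge0 k (u : 'rV[R]_k) : 0 <= dot u u.
Proof. by rewrite dot_sum sumr_ge0 // => j _; apply: sqr_ge0. Qed.

Lemma enormE k (u : 'rV[R]_k) : enorm u = Num.sqrt (dot u u).
Proof. by rewrite dot_sum. Qed.

Lemma sqr_enorm k (u : 'rV[R]_k) : enorm u ^+ 2 = dot u u.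
Proof. by rewrite enormE sqr_sqrtr ?dot_ge0. Qed.

Lemma enormZ k a (u : 'rV[R]_k) : enorm (a *: u) = `|a| * enorm u.
Proof.
by rewrite !enormE dotZl dotZr mulrA -expr2 sqrtrM ?sqr_ge0 // sqrtr_sqr.
Qed.

Lemma enormN k (u : 'rV[R]_k) : enorm (- u) = enorm u.
Proof. by rewrite -scaleN1r enormZ normrN1 mul1r. Qed.

Lemma enorm_eq0 k (u : 'rV[R]_k) : enorm u = 0 -> u = 0.
Proof.
move=> u0; have /eqP := sqr_enorm u; rewrite u0 expr0n /= eq_sym dot_sum.
rewrite psumr_eq0 => [/allP z|j _]; last exact: sqr_ge0.
apply/rowP => j; apply/eqP; rewrite mxE -sqrf_eq0.
exact: (implyP (z j (mem_index_enum j))).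
Qed.

(** The foot c0 of the perpendicular from c to the plane is the centre of the
    circle, by Pythagoras; two distinct points exclude radius zero. *)
Lemma sphere_section_concyclic (F : 'M[R]_(2, 3)) k (P : 'I_k -> 'rV[R]_3)
    (c : 'rV[R]_3) (i0 i1 : 'I_k) :
  is_frame F -> in_plane_along F P -> P i0 != P i1 ->
  (forall i j, dot (P i - c) (P i - c) = dot (P j - c) (P j - c)) ->
  concyclic P.
Proof.
move=> hF hP ne hc.
pose w := c - P i0; pose c0 := P i0 + w *m F^T *m F.
have inF i : (P i - c0 <= F)%MS.
  by rewrite opprD addrA addmx_sub // -mulNmx submxMl.
have pythagoras i :
    dot (P i - c) (P i - c) =
    dot (P i - c0) (P i - c0) + dot (c0 - c) (c0 - c).
  have -> : P i - c = (P i - c0) + (c0 - c) by rewrite addrA subrK.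
  suff orth : dot (P i - c0) (c0 - c) = 0.
    by rewrite dotDl !(dotDr (P i - c0)) (dotC (c0 - c)) orth addr0 add0r.
  have /submxP[a ->] := inF i.
  have -> : c0 - c = - (w - w *m F^T *m F).
    have ew : c = P i0 + w by rewrite addrC subrK.
    by rewrite /c0 opprB [X in _ - X = _]ew opprD addrACA subrr add0r.
  have wF : (w - w *m F^T *m F) *m F^T = 0.
    by rewrite mulmxBl -(mulmxA _ F) hF mulmx1 subrr.
  by rewrite dotNr dotC /dot trmx_mul mulmxA wF mul0mx mxE oppr0.
have same i : enorm (P i - c0) = enorm (P i0 - c0).
  rewrite !enormE; congr (Num.sqrt _).
  by have := hc i i0; rewrite !pythagoras; apply: addIr.
exists F, c0, (enorm (P i0 - c0)); split=> [//||i]; last by split.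
rewrite lt_def {2}enormE sqrtr_ge0 andbT.
apply: contraNneq ne => r0.
have at0 i : P i = c0.
  by apply/eqP; rewrite -subr_eq0 (@enorm_eq0 _ (P i - c0)) ?same.
by rewrite !at0.
Qed.

(** If x and y are equally long, u and v are equally long, and the lines x + Ru
    and y + Rv meet at equal parameter t, then u - v is a nonzero multiple of
    x - y; the linear reflection that exchanges x and y then also exchanges u
    and v, and it preserves inner products. *)
Lemma edge_symmetry k (x y u v : 'rV[R]_k) (t : R) :
  dot x x = dot y y -> dot u u = dot v v -> x != y ->
  x + t *: u = y + t *: v -> dot x u = dot y v.
Proof.
move=> hx hu ne meet.
have t0 : t != 0.
  by apply: contraNneq ne => t0; move: meet; rewrite t0 !scale0r !addr0 => ->.
have ey : y = x + t *: (u - v) by rewrite scalerBr addrA meet addrK.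
apply: (mulfI t0); move: hx; rewrite {}ey !dotE.
rewrite !(dotC u x) !(dotC v x) !(dotC v u) hu => hx.
by lra.
Qed.

End Circles.

(** * Offset nets *)

(** The boundary path of a face is connected: equality across edges propagates
    to vertices that are not joined by an edge. *)
Lemma face_edge_invariant (T : Type) (g : Z2 -> T) (f : Z2) :
  (forall i j : 'I_4, elem_edge (f + corner i) (f + corner j) ->
     g (f + corner i) = g (f + corner j)) ->
  forall i j : 'I_4, g (f + corner i) = g (f + corner j).
Proof.
move=> hg.
pose o0 : 'I_4 := inord 0; pose o1 : 'I_4 := inord 1.
pose o2 : 'I_4 := inord 2; pose o3 : 'I_4 := inord 3.
have c0 : corner o0 = (0, 0) by rewrite /corner (tnth_nth 0) inordK.
have c1 : corner o1 = (1, 0) by rewrite /corner (tnth_nth 0) inordK.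
have c2 : corner o2 = (1, 1) by rewrite /corner (tnth_nth 0) inordK.
have c3 : corner o3 = (0, 1) by rewrite /corner (tnth_nth 0) inordK.
have e01 : g (f + corner o0) = g (f + corner o1).
  by apply: hg; left; rewrite c0 c1 -addrA.
have e12 : g (f + corner o1) = g (f + corner o2).
  by apply: hg; right; rewrite c1 c2 -addrA.
have e03 : g (f + corner o0) = g (f + corner o3).
  by apply: hg; right; rewrite c0 c3 -addrA.
suff to0 (i : 'I_4) : g (f + corner i) = g (f + corner o0).
  by move=> i j; rewrite !to0.
have : i \in [:: o0; o1; o2; o3].
  by case: i => [[|[|[|[|]]]] ?]; rewrite // !inE -!val_eqE /= !inordK.
by rewrite !inE => /or4P[] /eqP->; rewrite -?e03 -?e12 -?e01.
Qed.

Section Offsets.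
Variable R : realType.
Implicit Types (m s : Z2 -> 'rV[R]_3) (F : 'M[R]_(2, 3)).

Lemma not_free_scaled (V : vectType R) (w : V) (a b : R) :
  ~~ free [:: a *: w; b *: w].
Proof.
rewrite free_cons seq1_free span_seq1.
case: (eqVneq b 0) => [->|b0]; first by rewrite scale0r eqxx andbF.
have -> : a *: w = (a / b) *: (b *: w) by rewrite scalerA divfK.
by rewrite memvZ ?memv_line.
Qed.

Lemma not_freeC (V : vectType R) (u v : V) :
  ~~ free [:: u; v] -> ~~ free [:: v; u].
Proof. by rewrite (@perm_free _ _ _ [:: v; u]) // (perm_catC [:: u] [:: v]). Qed.

Lemma christoffel_dual_sym m m' :
  christoffel_dual m m' -> christoffel_dual m' m.
Proof.
case=> hm hm' par hf; split=> // [n n' e|f]; first exact/not_freeC/par.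
by have [F [h1 h2 h3 h4]] := hf f; exists F; split; rewrite 1?mixed_areaC.
Qed.

Lemma in_plane_along_offset F m s t f :
  in_plane_along F (face m f) -> in_plane_along F (face s f) ->
  in_plane_along F (face (offset m s t) f).
Proof.
move=> hm hs i j; rewrite /face /offset.
have -> (a b c d : 'rV[R]_3) : a + t *: b - (c + t *: d) = a - c + t *: (b - d).
  by rewrite opprD addrACA scalerBr.
by rewrite addmx_sub ?hm // scalemx_sub ?hs.
Qed.

Lemma coords_offset F m s t f :
  coords F (face (offset m s t) f) =1
  (fun i => 1 *: coords F (face m f) i + t *: coords F (face s f) i).
Proof. by move=> i; rewrite /coords mulmxDl scale1r scalemxAl. Qed.

(** This is the discrete Steiner formula. *)
Lemma area_offset F m s t f :
  area (coords F (face (offset m s t) f)) =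
  area (coords F (face m f)) +
  2 * t * mixed_area (coords F (face m f)) (coords F (face s f)) +
  t ^+ 2 * area (coords F (face s f)).
Proof. by rewrite (eq_area (coords_offset F m s t f)) area_comb; ring. Qed.

Lemma mixed_area_offset F m s t f :
  mixed_area (coords F (face m f)) (coords F (face (offset m s t) f)) =
  area (coords F (face m f)) +
  t * mixed_area (coords F (face m f)) (coords F (face s f)).
Proof.
rewrite (@eq_mixed_area _ _ _ (fun i => 1 *: coords F (face m f) i +
  0 *: coords F (face s f) i) _ _ _ (coords_offset F m s t f)).
  by rewrite mixed_area_comb; ring.
by move=> i; rewrite scale1r scale0r addr0.
Qed.

Lemma mixed_area_offsetN F m s t f :
  mixed_area (coords F (face (offset m s t) f))
             (coords F (face (fun n => - s n) f)) =
  - (mixed_area (coords F (face m f)) (coords F (face s f)) +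
     t * area (coords F (face s f))).
Proof.
rewrite (@eq_mixed_area _ _ _ _ _ (fun i => 0 *: coords F (face m f) i +
  (-1) *: coords F (face s f) i) (coords_offset F m s t f)).
  by rewrite mixed_area_comb; ring.
by move=> i; rewrite scale0r add0r scaleN1r /coords mulNmx.
Qed.

Section Principal.
Variables m s : Z2 -> 'rV[R]_3.
Hypothesis ms : principal_contact_element_net m s.

(** The normal lines at the ends of an edge meet at the common parameter r, where
    the offset edge shrinks to a point. In particular all offsets have parallel
    edges, each a multiple of the same edge of s. *)
Lemma offset_edge n n' : elem_edge n n' ->
  exists r : R, forall t,
    offset m s t n - offset m s t n' = (t - r) *: (s n - s n').
Proof.
case: ms => _ pr _ _ _ /pr[r meet]; exists r => t.
have shift p : offset m s t p = offset m s r p + (t - r) *: s p.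
  by rewrite /offset scalerBl addrC -addrA subrKC addrC.
by rewrite !shift meet opprD addrACA subrr add0r scalerBr.
Qed.

Lemma face_frame f : exists F, [/\ is_frame F,
  in_plane_along F (face m f) & in_plane_along F (face s f)].
Proof. by case: ms => _ _ _ _ /(_ f)[F ?]; exists F. Qed.

Lemma offset0 n : offset m s 0 n = m n.
Proof. by rewrite /offset scale0r addr0. Qed.

Lemma offset_parallel t : parallel m (offset m s t).
Proof.
move=> n n' /offset_edge[r h].
have := h 0; rewrite !offset0 h => ->.
exact: not_free_scaled.
Qed.

Lemma offset_parallel_normal t : parallel (offset m s t) (fun n => - s n).
Proof.
move=> n n' /offset_edge[r h].
by rewrite h -opprD -[in X in [:: _; X]]scaleN1r not_free_scaled.
Qed.

Lemma offset_Qnet t : Qnet (offset m s t).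
Proof.
move=> f; have [F [hF hm hs]] := face_frame f.
by exists F; split=> //; exact: in_plane_along_offset.
Qed.

(** A circle through a face of m and its axis give a sphere about the same
    centre through the corresponding face of any offset: the cross term
    (m - c) . s in the squared distance to c is constant on the face by
    [edge_symmetry], applied to each of its edges. *)
Lemma offset_face_spherical t f : exists c : 'rV[R]_3, forall i j,
  dot (face (offset m s t) f i - c) (face (offset m s t) f i - c) =
  dot (face (offset m s t) f j - c) (face (offset m s t) f j - c).
Proof.
have [unit_s pr [[_ circ] [_ nz]] _ _] := ms.
have [F [c [r [_ _ hr]]]] := circ f; exists c.
have mr i : dot (m (f + corner i) - c) (m (f + corner i) - c) = r ^+ 2.
  by have [_ <-] := hr i; rewrite sqr_enorm.
have s1 n : dot (s n) (s n) = 1 by rewrite -sqr_enorm unit_s expr1n.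
have cross : forall i j : 'I_4,
    dot (m (f + corner i) - c) (s (f + corner i)) =
    dot (m (f + corner j) - c) (s (f + corner j)).
  apply: (@face_edge_invariant _ (fun n => dot (m n - c) (s n))) => i j e.
  have [p meet] := pr _ _ e.
  apply: (@edge_symmetry _ _ _ _ _ _ p); rewrite ?mr ?s1 //.
    by rewrite (inj_eq (addIr _)) nz.
  by rewrite ![_ - c + _]addrAC; congr (_ - c).
have expand i : dot (face (offset m s t) f i - c) (face (offset m s t) f i - c) =
    r ^+ 2 + 2 * t * dot (m (f + corner i) - c) (s (f + corner i)) + t ^+ 2.
  have := mr i; rewrite /face /offset addrAC; move: (m _ - c) => x hx.
  by rewrite !dotE s1 hx (dotC (s _)); ring.
by move=> i j; rewrite !expand (cross i j).
Qed.

Lemma offset_circular t :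
  without_zero_edges (offset m s t) -> circular (offset m s t).
Proof.
move=> nz; split=> [|f]; first exact: offset_Qnet.
have [F [hF hm hs]] := face_frame f.
have [c hc] := offset_face_spherical t f.
apply: (@sphere_section_concyclic _ F _ _ c (inord 0) (inord 1)) hc => //.
  exact: in_plane_along_offset.
apply: nz; left; rewrite /corner !(tnth_nth 0) !inordK //=.
by rewrite -addrA.
Qed.

Lemma offset_polyhedral t :
  without_zero_edges (offset m s t) -> polyhedral (offset m s t).
Proof. by move=> nz; split=> //; exact: offset_Qnet. Qed.

Lemma offset_opposite_principal t : without_zero_edges (offset m s t) ->
  principal_contact_element_net (offset m s t) (fun n => - s n).
Proof.
move=> nz; have [unit_s pr _ _ _] := ms; split.
- by move=> n; rewrite enormN unit_s.
- move=> n n' /pr[r meet]; exists (t - r).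
  have flip p : offset (offset m s t) (fun n => - s n) (t - r) p = offset m s r p.
    by rewrite /offset scalerN -addrA -scalerBl subKr.
  by rewrite !flip.
- by split; [exact: offset_circular | exact: offset_polyhedral].
- exact: offset_parallel_normal.
- move=> f; have [F [hF hm hs]] := face_frame f; exists F; split=> //.
    exact: in_plane_along_offset.
  by move=> i j; rewrite /face -opprD eqmx_opp hs.
Qed.

End Principal.
End Offsets.

(** * Constant mean curvature *)

Section ConstantMeanCurvature.
Variables (R : realType) (H0 : R) (m s : Z2 -> 'rV[R]_3).
Hypothesis H0_neq0 : H0 != 0.
Hypothesis ms : principal_contact_element_net m s.

Lemma mixed_area_of_mean_curvature (F : 'M[R]_(2, 3)) f :
  area (coords F (face m f)) != 0 ->
  mean_curvature F (face m f) (face s f) = H0 <->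
  mixed_area (coords F (face m f)) (coords F (face s f)) =
  - (H0 * area (coords F (face m f))).
Proof.
rewrite /mean_curvature => nz; split=> [<-|->]; first by field.
by field.
Qed.

Lemma cmc_christoffel_dual :
  without_zero_edges (offset m s H0^-1) ->
  has_constant_mean_curvature m s H0 ->
  christoffel_dual m (offset m s H0^-1).
Proof.
move=> nz cmc; split.
- by have [_ _ [_ ?] _ _] := ms.
- exact: offset_polyhedral.
- exact: offset_parallel.
- move=> f; have [F [hF hm hs am]] := cmc f.
  move/(mixed_area_of_mean_curvature am) => e; exists F; split=> //.
    exact: in_plane_along_offset.
  by rewrite mixed_area_offset e; field.
Qed.

Lemma christoffel_dual_cmc m' :
  nonvanishing_face_areas m -> christoffel_dual m m' ->
  (forall n, s n = H0 *: (m' n - m n)) ->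
  has_constant_mean_curvature m s H0.
Proof.
move=> areas [_ _ _ dual] es f; have [F [hF hm hm' e0]] := dual f.
have am := area_neq0_frame hF hm (areas f).
have hs : in_plane_along F (face s f).
  move=> i j; rewrite /face !es -scalerBr scalemx_sub //.
  rewrite opprD addrACA -opprD addmx_sub ?eqmx_opp //.
    exact: hm'.
  exact: hm.
exists F; split=> //; apply/(mixed_area_of_mean_curvature am).
move: e0; rewrite (@eq_mixed_area _ _ _ (coords F (face m f)) _
  (coords F (face (offset m s H0^-1) f))) // => [|i].
  rewrite mixed_area_offset => e0; apply: (mulfI (invr_neq0 H0_neq0)).
  by rewrite mulrN mulKf //; apply/eqP; rewrite -addr_eq0 addrC e0.
by rewrite /coords /face /offset es scalerA mulVf // scale1r subrKC.
Qed.

(** With A(m, s) = - H0 A(m), both A(m') = - A(m) + A(s) / H0^2 and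
    A(m', s) = - H0 A(m) + A(s) / H0 are multiples of the same number, and
    their ratio is H0. *)
Lemma parallel_surface_cmc :
  has_constant_mean_curvature m s H0 ->
  nonvanishing_face_areas (offset m s H0^-1) ->
  has_constant_mean_curvature (offset m s H0^-1) (fun n => - s n) H0.
Proof.
move=> cmc areas f; have [F [hF hm hs am]] := cmc f.
move/(mixed_area_of_mean_curvature am) => e.
have hm' := in_plane_along_offset H0^-1 hm hs.
have am' := area_neq0_frame hF hm' (areas f).
exists F; split=> //.
  by move=> i j; rewrite /face -opprD eqmx_opp hs.
move: am'; rewrite /mean_curvature mixed_area_offsetN area_offset e.
set num := - (H0 * _) + _; set den := _ + _ => den0.
have -> : num = H0 * den by rewrite /num /den; field.
by rewrite mulNr opprK mulfK.
Qed.

(** With A(m, s) = - H0 A(m), the terms in A(m) cancel at distance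
    1 / (2 H0), and the area of the offset is A(s) / (4 H0^2). *)
Lemma mid_surface_constant_gauss_curvature :
  has_constant_mean_curvature m s H0 ->
  nonvanishing_face_areas (offset m s (2 * H0)^-1) ->
  has_constant_gauss_curvature (offset m s (2 * H0)^-1) s (4 * H0 ^+ 2).
Proof.
move=> cmc areas f; have [F [hF hm hs am]] := cmc f.
move/(mixed_area_of_mean_curvature am) => e.
have hm' := in_plane_along_offset (2 * H0)^-1 hm hs.
have am' := area_neq0_frame hF hm' (areas f).
exists F; split=> //; rewrite /gauss_curvature.
move: am'; rewrite area_offset e.
set b := area (coords F (face s f)); set den := _ + _ => den0.
have -> : b = 4 * H0 ^+ 2 * den by rewrite /den; field.
by rewrite mulfK.
Qed.

End ConstantMeanCurvature.

Theorem corollary19 (R : realType) (H0 : R) (m s : Z2 -> 'rV[R]_3)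
    (H0_neq0 : H0 != 0)
    (ms_principal : principal_contact_element_net m s)
    (m_areas : nonvanishing_face_areas m) :
  (without_zero_edges (offset m s H0^-1) ->
    (has_constant_mean_curvature m s H0 <->
     isothermic m /\
     exists m' : Z2 -> 'rV[R]_3,
       [/\ christoffel_dual m m', isothermic m',
           forall n, enorm (m n - m' n) = `|H0|^-1
         & forall n, s n = H0 *: (m' n - m n)]))
  /\
  (has_constant_mean_curvature m s H0 ->
    [/\ without_zero_edges (offset m s H0^-1) ->
          principal_contact_element_net (offset m s H0^-1) (fun n => - s n),
        nonvanishing_face_areas (offset m s H0^-1) ->
          has_constant_mean_curvature (offset m s H0^-1) (fun n => - s n) H0
      & nonvanishing_face_areas (offset m s (2 * H0)^-1) ->
          has_constant_gauss_curvature (offset m s (2 * H0)^-1) s (4 * H0 ^+ 2)]).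
Proof.
split=> [nz|cmc]; last first.
  split; [exact: offset_opposite_principal | exact: parallel_surface_cmc |].
  exact: mid_surface_constant_gauss_curvature.
split=> [cmc|[_ [m' [dual _ _ es]]]]; last exact: christoffel_dual_cmc dual es.
have [unit_s _ [circ_m poly_m] _ _] := ms_principal.
have dual := cmc_christoffel_dual H0_neq0 ms_principal nz cmc.
split; first by split=> //; split=> //; exists (offset m s H0^-1).
exists (offset m s H0^-1); split=> //.
- split; first exact: offset_circular.
  split; first exact: offset_polyhedral.
  by exists m; exact: christoffel_dual_sym.
- by move=> n; rewrite opprD addNKr enormN enormZ unit_s mulr1 normfV.
- by move=> n; rewrite addrC addKr scalerA divff // scale1r.
Qed.
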